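(* For each integer $m\ge 1$ let $a_m$ denote the number of fundamental models in $\Delta_m$ of degree $2m-1$. For every $n\ge 3$, the number of fundamental models in $\Delta_n$ of degree $2n-2$ is at least $$2\,(a_1a_{n-1}+a_2a_{n-2}+\ldots+a_{n-1}a_1).$$
   Context: A reduced model in the probability simplex $\Delta_n=\{p\in\mathbb{R}^{n+1}\mid \sum_i p_i=1,\ p_i\ge 0\}$ is given by a collection of $n+1$ triples $(c_i,\nu_i,\mu_i)_{i=0}^n$ with $c_i\in\mathbb{R}_{>0}$ and $\nu_i,\mu_i\in\mathbb{N}=\{0,1,2,\ldots\}$ such that the pairs $(\nu_i,\mu_i)$ are pairwise distinct and all different from $(0,0)$, and $\sum_{i=0}^n c_i t^{\nu_i}(1-t)^{\mu_i}=1$ for all $t\in[0,1]$. Its degree is $\max_i(\nu_i+\mu_i)$. It is fundamental if, given the exponent pairs $(\nu_i,\mu_i)$, the scalings $c_i$ are uniquely determined by the constraint $\sum_{i=0}^n c_i t^{\nu_i}(1-t)^{\mu_i}=1$ (as a polynomial identity in $t$). Models are counted up to reordering of the coordinates, i.e. as sets of triples $\{(c_i,\nu_i,\mu_i)\}$; models related by exchanging $t$ and $1-t$ (swapping all $\nu_i$ with $\mu_i$) count as different whenever the sets of triples differ. The number of fundamental models in $\Delta_n$ of any given degree is finite. *)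

(* Defs.v *)
From mathcomp Require Import all_boot all_order all_algebra finmap.
From mathcomp Require Import classical_sets boolp functions cardinality reals.

Set Implicit Arguments.
Unset Strict Implicit.
Unset Printing Implicit Defensive.

Import Order.TTheory GRing.Theory Num.Theory.

Local Open Scope ring_scope.
Local Open Scope fset_scope.
Local Open Scope classical_set_scope.

Record reduced_model (R : realType) (n : nat)
    (c : 'I_n.+1 -> R) (nu mu : 'I_n.+1 -> nat) : Prop := ReducedModel {
  scaling_gt0 : forall i, 0 < c i;
  exponents_inj : injective (fun i => (nu i, mu i));
  exponents_neq0 : forall i, (nu i, mu i) <> (0%N, 0%N);
  total_mass : forall t : R, 0 <= t <= 1 ->
    \sum_(i < n.+1) c i * t ^+ nu i * (1 - t) ^+ mu i = 1
}.

Definition model_degree (n : nat) (nu mu : 'I_n.+1 -> nat) : nat :=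
  \max_(i < n.+1) (nu i + mu i)%N.

(* The competing scalings c' range over all real tuples. Restricting to
   positive c' gives the same notion: c is positive, so any other real
   solution yields another positive one close to c. *)
Definition fundamental (R : realType) (n : nat)
    (c : 'I_n.+1 -> R) (nu mu : 'I_n.+1 -> nat) : Prop :=
  reduced_model c nu mu /\
  forall c' : 'I_n.+1 -> R,
    \sum_(i < n.+1) c' i *: ('X ^+ nu i * (1 - 'X) ^+ mu i) = 1 :> {poly R} ->
    c' =1 c.

Definition triples (R : realType) (n : nat)
    (c : 'I_n.+1 -> R) (nu mu : 'I_n.+1 -> nat) : {fset (R * nat * nat)%type} :=
  [fset (c i, nu i, mu i) | i in 'I_n.+1].

Definition fundamental_models (R : realType) (n d : nat) :
    set {fset (R * nat * nat)%type} :=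
  [set M | exists (c : 'I_n.+1 -> R) (nu mu : 'I_n.+1 -> nat),
     [/\ fundamental c nu mu, model_degree nu mu = d & M = triples c nu mu]].
Arguments fundamental_models : clear implicits.

(* [fset_set] is a dummy value on infinite sets; by
   [fundamental_models_finite] below this never happens here. *)
Definition num_fundamental (R : realType) (n d : nat) : nat :=
  #|` fset_set (fundamental_models R n d)|.

Definition sharp_count (R : realType) (m : nat) : nat :=
  num_fundamental R m (2 * m - 1)%N.

Lemma sum_polyE (R : realType) (n : nat) (c : 'I_n.+1 -> R)
    (nu mu : 'I_n.+1 -> nat) :
  reduced_model c nu mu ->
  \sum_(i < n.+1) c i *: ('X ^+ nu i * (1 - 'X) ^+ mu i) = 1 :> {poly R}.
Proof.
case=> _ _ _ hs; apply/eqP; rewrite -subr_eq0; apply/negPn/negP => p0.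
set p := (X in X != 0) in p0.
pose s := [seq (k.+1%:R : R)^-1 | k <- iota 0 (size p)].
have : (size s < size p)%N.
  apply: max_poly_roots => //.
    apply/allP => _ /mapP[k _ ->].
    have ht : 0 <= (k.+1%:R : R)^-1 <= 1.
      by rewrite invr_ge0 ler0n /= invf_le1 ?ltr0n // ler1n.
    rewrite /root /p hornerD hornerN horner_sum hornerC subr_eq0 -[eqbRHS](hs _ ht).
    apply/eqP/eq_bigr => i _.
    by rewrite hornerZ hornerM !horner_exp hornerD hornerN hornerC hornerX mulrA.
  rewrite map_inj_uniq ?iota_uniq // => a b /invr_inj /eqP.
  by rewrite eqr_nat eqSS => /eqP.
by rewrite size_map size_iota ltnn.
Qed.

Lemma fundamental_models_finite (R : realType) (n d : nat) :
  finite_set (fundamental_models R n d).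
Proof.
pose E := {ffun 'I_n.+1 -> 'I_d.+1 * 'I_d.+1}.
pose P (e : E) (c : 'I_n.+1 -> R) :=
  fundamental c (fun i => val (e i).1) (fun i => val (e i).2).
pose g (e : E) : {fset (R * nat * nat)%type} :=
  match pselect (exists c, P e c) with
  | left h => triples (projT1 (cid h)) (fun i => val (e i).1) (fun i => val (e i).2)
  | right _ => fset0
  end.
apply: (@sub_finite_set _ _ (range g)); last first.
  by apply: finite_image; exact: finite_finset.
move=> _ [c [nu [mu [fc dd ->]]]].
have hle i : (nu i + mu i <= d)%N.
  by rewrite -dd; exact: (leq_bigmax (F := fun i => (nu i + mu i)%N)).
have hnu i : (nu i < d.+1)%N by rewrite ltnS; apply: leq_trans (hle i); exact: leq_addr.
have hmu i : (mu i < d.+1)%N by rewrite ltnS; apply: leq_trans (hle i); exact: leq_addl.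
pose e : E := [ffun i => (Ordinal (hnu i), Ordinal (hmu i))].
have enu : (fun i => val (e i).1) = nu by apply/funext => i; rewrite ffunE.
have emu : (fun i => val (e i).2) = mu by apply/funext => i; rewrite ffunE.
exists e => //; rewrite /g; case: pselect => [h|]; last first.
  by case; exists c; rewrite /P enu emu.
case: cid => c1 /=; rewrite /P enu emu => -[rc1 _].
by have -> : c1 = c by apply/funext; apply: fc.2; exact: sum_polyE.
Qed.

(* Main.v *)
(* Replacing a term tau of top degree d in a model f by the product of tau with a
   model g yields a fundamental model again: a relation A + tau * B = 1 between its
   monomials forces B to be constant, since deg A <= d = deg tau. If f has degree
   2m - 1 and lies in Delta_m, and g has degree 2(n - m) - 1 and lies in Delta_(n-m),
   the result has degree 2n - 2 and lies in Delta_n. As the coefficients of t^d in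
   the terms of f cancel, f has top terms tau with mu even and with mu odd, whence
   the factor 2.

   The terms of degree at most 2m - 1 of the result determine tau and f, hence g. If
   the same model also arose from some m' > m, then f' would arise from f by replacing
   tau with its product with a model in Delta_(m'-m) of degree 2(m' - m). This
   contradicts the bound of D'Angelo, Kos and Riehl: a model in Delta_k has degree at
   most 2k - 1.

   For that bound, write P(x, y) - 1 = (x + y - 1) Q(x, y), where P is the sum of the
   terms and x stands for 1 - t. The coefficients Q_a(y) of x^a satisfy
   Q_(a-1) = P_a + (1 - y) Q_a, and one follows the number of sign changes of Q_a(-y).
   Multiplication by 1 + y does not increase it and a monomial changes it by at most 2,
   so it is bounded above by twice the number of terms with larger a. The terms with
   smaller a bound from above the deficit between deg Q_a and this number. *)

Require Import Defs.
From mathcomp Require Import all_boot all_order all_algebra finmap.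
From mathcomp Require Import classical_sets boolp functions cardinality reals.
From mathcomp Require Import zify ring.

Set Implicit Arguments.
Unset Strict Implicit.
Unset Printing Implicit Defensive.

Import Order.TTheory GRing.Theory Num.Theory.

Local Open Scope fset_scope.
Local Open Scope ring_scope.

(** * Sign changes along increasing sequences of indices *)

Section SignChanges.
Variable R : realDomainType.
Implicit Types (f g : nat -> R) (k i j : nat).

(* [sign_chain f k i]: along some increasing sequence of indices ending at [i], the
   sequence [f] changes sign [k] times. *)
Inductive sign_chain f : nat -> nat -> Prop :=
| sign_chain0 i : f i != 0 -> sign_chain f 0 i
| sign_chainS k i j : sign_chain f k i -> (i < j)%N -> f i * f j < 0 -> sign_chain f k.+1 j.

Lemma sign_chain_neq0 f k i : sign_chain f k i -> f i != 0.
Proof. by case=> // k' j i' _ _; apply: contraTneq => ->; rewrite mulr0 ltxx. Qed.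

Lemma sign_chain_eq f g k i : (forall j, (j <= i)%N -> f j = g j) ->
  sign_chain f k i -> sign_chain g k i.
Proof.
move=> efg a; elim: a efg => [j nz|k' j l _ IH jl lt0] e; first by apply: sign_chain0; rewrite -e.
apply: (sign_chainS (i := j)) => //; last by rewrite -!e // ltnW.
by apply: IH => x xj; apply: e; lia.
Qed.

Lemma mul_gt0_lt0 (x y z : R) : 0 < x * y -> x * z < 0 -> y * z < 0.
Proof.
case: (ltgtP x 0) => [x0|x0|->]; last by rewrite mul0r ltxx.
  by rewrite !nmulr_rgt0 // nmulr_rlt0 // => y0 z0; rewrite nmulr_rlt0.
by rewrite !pmulr_rgt0 // pmulr_rlt0 // => y0 z0; rewrite pmulr_rlt0.
Qed.

Lemma mul_lt0_lt0 (x y z : R) : x * y < 0 -> y * z < 0 -> 0 < x * z.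
Proof.
case: (ltgtP y 0) => [y0|y0|->]; last by rewrite mulr0 ltxx.
  by rewrite nmulr_llt0 // nmulr_rlt0 // => *; apply: mulr_gt0.
by rewrite pmulr_llt0 // pmulr_rlt0 // => *; rewrite nmulr_lgt0.
Qed.

Lemma sign_chain_move f k i j : sign_chain f k i -> (i <= j)%N -> 0 < f i * f j -> sign_chain f k j.
Proof.
case=> [l nz lj|k' l m a lm lt0 mj] gt0.
  by apply: sign_chain0; apply: contraTneq gt0 => ->; rewrite mulr0 ltxx.
apply: (sign_chainS a); first exact: leq_trans mj.
by rewrite mulrC; apply: mul_gt0_lt0 gt0 _; rewrite mulrC.
Qed.

(** If the signs at [i] and [j] agree, the last index moves to [j]; otherwise [j] adds a change. *)
Lemma sign_chain_extend f k i j : sign_chain f k i -> (i <= j)%N -> f j != 0 ->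
  exists2 k', (k <= k')%N & sign_chain f k' j.
Proof.
move=> a ij fj; have fi := sign_chain_neq0 a.
have [lt0|gt0|e] := ltgtP (f i * f j) 0.
- exists k.+1 => //; apply: (sign_chainS a) => //; rewrite ltn_neqAle ij andbT.
  apply: contraTneq lt0 => ->; rewrite -leNgt -expr2; exact: sqr_ge0.
- by exists k => //; apply: sign_chain_move a ij gt0.
- by move/eqP: e; rewrite mulf_eq0 (negPf fi) (negPf fj).
Qed.

Lemma sign_chain_run f k i m : sign_chain f k i ->
  (forall j, (i <= j < i + m)%N -> f j * f j.+1 < 0) -> sign_chain f (k + m) (i + m).
Proof.
move=> a; elim: m => [|m IH] H; first by rewrite !addn0.
rewrite !addnS; apply: (sign_chainS (IH _)) => // [j hj|]; apply: H; lia.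
Qed.

(* Each [g i + g i.-1] with a nonzero sign has a summand of the same sign, and the
   summands so selected at successive sign changes occur in the same order. *)
Lemma sign_chain_mul1p f g k i :
  f 0%N = g 0%N -> (forall j, f j.+1 = g j.+1 + g j) ->
  sign_chain f k i -> exists l, [/\ (l <= i)%N, (i <= l.+1)%N, 0 < g l * f i & sign_chain g k l].
Proof.
move=> f0 fS.
have pick j : f j != 0 -> exists l, [/\ (l <= j)%N, (j <= l.+1)%N & 0 < g l * f j].
  case: j => [nz|j nz].
    by exists 0%N; split=> //; rewrite -f0 -expr2 lt_def sqrf_eq0 nz sqr_ge0.
  have : 0 < f j.+1 * f j.+1 by rewrite -expr2 lt_def sqrf_eq0 nz sqr_ge0.
  rewrite {1}fS mulrDl => h.
  have [p|p] := ltP 0 (g j.+1 * f j.+1); first by exists j.+1.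
  by exists j; split=> //; apply: lt_le_trans h _; rewrite gerDr.
elim=> [j nz|k' j m a [l [lj jl gt0 al]] jm lt0].
  by have [l [lj jl gt0]] := pick _ nz; exists l; split=> //; apply: sign_chain0;
    apply: contraTneq gt0 => ->; rewrite mul0r ltxx.
have nz : f m != 0 by apply: contraTneq lt0 => ->; rewrite mulr0 ltxx.
have [l' [l'm ml' gt0']] := pick _ nz.
have lt0' : g l * g l' < 0.
  have : g l * f m < 0 by apply: (mul_gt0_lt0 (x := f j)) => //; rewrite mulrC.
  by move=> h; rewrite mulrC; apply: (mul_gt0_lt0 (x := f m)); rewrite mulrC.
exists l'; split=> //; apply: (sign_chainS al) => //.
rewrite ltn_neqAle; apply/andP; split; last by lia.
apply: contraTneq lt0' => ->; rewrite -leNgt -expr2; exact: sqr_ge0.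
Qed.

(** Drop the index [j] from the chain. At an end this costs at most one change; inside the chain the
    two neighbours of [j] have equal signs, so they merge and two changes are lost. *)
Lemma sign_chain_change1 f g j k i : (forall l, l != j -> f l = g l) ->
  sign_chain g k.+2 i -> exists i', sign_chain f k i'.
Proof.
move=> e.
(* For a chain ending at [j], its predecessor is remembered together with its sign relative to
   [g j]: the next index will be merged with that predecessor. *)
have H K l : sign_chain g K l ->
  [/\ (l < j)%N -> sign_chain f K l,
      l = j -> K = 0%N \/ exists2 l', (l' < j)%N & sign_chain f K.-1 l' /\ f l' * g j < 0
    & (j < l)%N -> sign_chain f K l \/ sign_chain f K.-1 l \/ sign_chain f K.-2 l].
  elim=> [m nz|K' m m' a [h1 h2 h3] mm' lt0]; split.
  - by move=> mj; apply: sign_chain0; rewrite e // ltn_eqF.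
  - by left.
  - by move=> mj; left; apply: sign_chain0; rewrite e // gtn_eqF.
  - move=> m'j; apply: (sign_chainS (h1 _) mm'); first exact: ltn_trans m'j.
    by rewrite !e ?ltn_eqF //; apply: ltn_trans m'j.
  - move=> ej; subst m'; right; exists m => //=; split; first exact: h1.
    by rewrite e // ltn_eqF.
  - move=> jm'; have fm' : f m' = g m' by rewrite e // gtn_eqF.
    have [mj|jm|mj] := ltngtP m j.
    + by left; apply: (sign_chainS (h1 mj) mm'); rewrite fm' e // ltn_eqF.
    + have lt1 : f m * f m' < 0 by rewrite fm' e // gtn_eqF.
      case: (h3 jm) => [al|[al|al]]; first by left; apply: sign_chainS lt1.
        by case: (K') al => [|K0] al; [left|right; left]; apply: sign_chainS lt1.
      by case: (K') al => [|[|K0]] al; [left|right; left|right; right]; apply: sign_chainS lt1.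
    + case: (h2 mj) => [->|[l' l'j [al' lt1]]].
        right; left => /=; apply: sign_chain0.
        by rewrite fm'; apply: contraTneq lt0 => ->; rewrite mulr0 ltxx.
      right; right => /=; apply: (sign_chain_move al'); first by lia.
      by rewrite fm'; apply: mul_lt0_lt0 lt1 _; rewrite -mj.
have weak K l : sign_chain f K.+1 l -> exists l', sign_chain f K l'.
  by move=> a; inversion a; eexists; eassumption.
move=> a; have [h1 h2 h3] := H _ _ a.
have w1 l : sign_chain f k.+1 l -> exists l', sign_chain f k l' by apply: weak.
have w2 l : sign_chain f k.+2 l -> exists l', sign_chain f k l' by move=> /weak[l'] /weak.
have [lt|gt|eq] := ltngtP i j.
- exact: w2 (h1 lt).
- by case: (h3 gt) => [/w2|[/w1|]] //= ?; exists i.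
- by case: (h2 eq) => [//|[l' _ [/w1]]].
Qed.

Lemma sign_chain_remove (T : Type) (e : T -> nat) (u : T -> R) (r : seq T) f k i :
  sign_chain (fun j => f j + \sum_(x <- r | e x == j) u x) (k + 2 * size r) i ->
  exists i', sign_chain f k i'.
Proof.
elim: r k i f => [|x r IH] k i f /=.
  rewrite muln0 addn0 => a; exists i; apply: sign_chain_eq a => j _.
  by rewrite big_nil addr0.
rewrite (_ : k + _ = (k + 2 * size r).+2)%N; last by lia.
move=> /(sign_chain_change1 (j := e x) (f := fun j => f j + \sum_(y <- r | e y == j) u y)).
case=> [l /negPf nl|i' /IH //].
by rewrite big_cons eq_sym nl.
Qed.

(** Removing all monomials but one costs two changes each and leaves at most one nonzero entry,
    hence no change at all. *)
Lemma sign_chain_monomials (T : Type) (e : T -> nat) (u : T -> R) (r : seq T) k i :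
  sign_chain (fun j => \sum_(x <- r | e x == j) u x) k i -> (k + 2 <= 2 * size r)%N.
Proof.
case: r => [|x r] a; first by have := sign_chain_neq0 a; rewrite big_nil eqxx.
rewrite leqNgt; apply/negP => /= lt.
have ek : (k = (k - 2 * size r).-1.+1 + 2 * size r)%N by lia.
have : sign_chain (fun j => (if e x == j then u x else 0) + \sum_(y <- r | e y == j) u y) k i.
  by apply: sign_chain_eq a => j _; rewrite big_cons; case: ifP => // _; rewrite add0r.
rewrite ek => /sign_chain_remove[i']; move: (_.-1) => m a'.
inversion a' as [|? l ? al li lt0]; subst; move: lt0.
case: eqP => [el|]; last by rewrite mul0r ltxx.
by case: eqP => [ei|]; [move: li; rewrite -el -ei ltnn|rewrite mulr0 ltxx].
Qed.

End SignChanges.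

(** * The quotient by x + y - 1 and the degree bound *)

Section DegreeBound.
Variable R : realDomainType.
Implicit Types (p q : {poly R}) (x : R * nat * nat) (r s : seq (R * nat * nat)).

(** These are the coefficients of q(-X). *)
Definition coefs_opp q (i : nat) : R := (-1) ^+ i * q`_i.

(** For the terms with a given second exponent a this is P_a(y), the coefficient of x^a in P(x,
    y). *)
Definition row_poly r : {poly R} := \sum_(x <- r) x.1.1 *: 'X^(x.1.2).

Lemma coef_row_poly r i : (row_poly r)`_i = \sum_(x <- r | x.1.2 == i) x.1.1.
Proof.
rewrite coef_sum [RHS]big_mkcond /=; apply: eq_bigr => x _.
by rewrite coefZ coefXn eq_sym; case: eqP; rewrite ?mulr1 ?mulr0.
Qed.

Lemma coefs_opp_row_poly r i :
  coefs_opp (row_poly r) i = \sum_(x <- r | x.1.2 == i) (-1) ^+ x.1.2 * x.1.1.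
Proof.
rewrite /coefs_opp coef_row_poly mulr_sumr; apply: eq_bigr => x /eqP -> //.
Qed.

Lemma coefs_oppD p q i : coefs_opp (p + q) i = coefs_opp p i + coefs_opp q i.
Proof. by rewrite /coefs_opp coefD mulrDr. Qed.

Lemma coef_mul1BX q i : ((1 - 'X) * q)`_i.+1 = q`_i.+1 - q`_i.
Proof. by rewrite mulrBl mul1r coefB coefXM. Qed.

Lemma coef0_mul1BX q : ((1 - 'X) * q)`_0 = q`_0.
Proof. by rewrite mulrBl mul1r coefB coefXM subr0. Qed.

(** Replacing X by -X turns the factor 1 - X into 1 + X. *)
Lemma sign_chain_mul1BX q k i : sign_chain (coefs_opp ((1 - 'X) * q)) k i ->
  exists2 l, (l <= i)%N & sign_chain (coefs_opp q) k l.
Proof.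
move=> /(sign_chain_mul1p (g := coefs_opp q)) [||l [li _ _ al]]; last by exists l.
  by rewrite /coefs_opp coef0_mul1BX.
by move=> j; rewrite /coefs_opp coef_mul1BX exprS; ring.
Qed.

Lemma sign_chain_next_row r p q k i : p = row_poly r + (1 - 'X) * q ->
  sign_chain (coefs_opp p) (k + 2 * size r) i -> exists l, sign_chain (coefs_opp q) k l.
Proof.
move=> e a.
have [l /sign_chain_mul1BX[m _ am]] : exists l, sign_chain (coefs_opp ((1 - 'X) * q)) k l.
  apply: (sign_chain_remove (e := fun x => x.1.2)
    (u := fun x => (-1) ^+ x.1.2 * x.1.1) (r := r) (i := i)).
  by apply: sign_chain_eq a => j _; rewrite e coefs_oppD coefs_opp_row_poly addrC.
by exists m.
Qed.

Lemma neq0_sign_chain q : q != 0 -> exists i, sign_chain (coefs_opp q) 0 i.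
Proof.
move=> q0; exists (size q).-1; apply: sign_chain0.
by rewrite /coefs_opp mulf_neq0 ?signr_eq0 // -lead_coefE lead_coef_eq0.
Qed.

(* When the degree does not drop, the new coefficients of [q] are positive and
   nonincreasing, so each of them contributes a sign change to [q(-X)], while at
   least one monomial of [row_poly r] sticks out of the degree of [p] and need not
   be removed. *)
Lemma sign_chain_next_row_large r p q k i : p = row_poly r + (1 - 'X) * q ->
  (forall x, x \in r -> 0 < x.1.1) -> p != 0 -> (size p <= size q)%N ->
  sign_chain (coefs_opp p) k i ->
  exists k' i', sign_chain (coefs_opp q) k' i' /\
    (k + size q + 2 <= k' + 2 * size r + size p)%N.
Proof.
move=> e r_gt0 p0 pq a; set z := size p in pq *.
have z0 : (0 < z)%N by rewrite size_poly_gt0.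
have q0 : q != 0 by rewrite -size_poly_gt0 (leq_trans z0).
(* Beyond the degree of [p] the left side of [e] vanishes, which leaves a downward recursion for the
   coefficients of [q]. *)
have rowS j : (z <= j.+1)%N -> q`_j = q`_j.+1 + (row_poly r)`_j.+1.
  move=> zj; have := congr1 (fun f : {poly R} => f`_j.+1) e.
  rewrite /= nth_default // coefD coef_mul1BX => h.
  rewrite -[LHS]addr0 [X in _ + X]h; ring.
have row_ge0 j : 0 <= (row_poly r)`_j.
  by rewrite coef_row_poly big_seq_cond sumr_ge0 // => x /andP[/r_gt0/ltW].
have q_noninc j m : (z.-1 <= j)%N -> q`_(j + m) <= q`_j.
  move=> zj; elim: m => [|m IH]; first by rewrite addn0.
  by rewrite addnS (le_trans _ IH) // (rowS (j + m)%N) ?lerDl //; lia.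
have q_ge0 j : (z.-1 <= j)%N -> 0 <= q`_j.
  by move=> zj; have := q_noninc j (size q) zj; rewrite [q`_(j + _)]nth_default ?leq_addl.
have lead_gt0 : 0 < q`_(size q).-1.
  by rewrite lt_def -lead_coefE lead_coef_eq0 q0 lead_coefE q_ge0 //; lia.
have q_gt0 j : (z.-1 <= j < size q)%N -> 0 < q`_j.
  move=> /andP[zj jq]; apply: (lt_le_trans lead_gt0).
  by have -> : (size q).-1 = (j + ((size q).-1 - j))%N; [lia|apply: q_noninc].
have has_large : has (fun x => ~~ (x.1.2 < z)%N) r.
  apply/hasPn => h; have : (row_poly r)`_(size q) = 0.
    rewrite coef_row_poly big1_seq // => x /andP[/eqP ex /h].
    by rewrite negbK ex ltnNge pq.
  have := rowS (size q).-1; rewrite prednK ?size_poly_gt0 // => /(_ pq).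
  by rewrite [q`_(size q)]nth_default // add0r => <- h0; rewrite h0 ltxx in lead_gt0.
pose r' := [seq x <- r | (x.1.2 < z)%N].
have size_r' : (size r' < size r)%N.
  rewrite size_filter -(count_predC (fun x => (x.1.2 < z)%N) r).
  by rewrite -[X in (X < _)%N]addn0 ltn_add2l -has_count.
(* As [p] has no coefficients from [z] on, adding the monomials of [r'] to this truncation gives
   p(-X), so only those of [r'] have to be removed. *)
pose f i := if (i < z)%N then coefs_opp ((1 - 'X) * q) i else 0.
(* Chains are pushed to the index [z.-1], where the alternating run starts. *)
have fP k0 l : sign_chain f k0 l -> exists k', (k0 <= k')%N /\ sign_chain (coefs_opp q) k' z.-1.
  move=> al; have := sign_chain_neq0 al; rewrite {1}/f; case: ltnP => [lz _|]; last by rewrite eqxx.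
  have /sign_chain_mul1BX[m ml am] : sign_chain (coefs_opp ((1 - 'X) * q)) k0 l.
    by apply: sign_chain_eq al => j jl; rewrite /f (leq_ltn_trans jl).
  have [] := sign_chain_extend (j := z.-1) am; first by lia.
    by rewrite mulf_neq0 ?signr_eq0 // gt_eqF // q_gt0 //; lia.
  by move=> k' kk' ak'; exists k'.
have [k' [kk' ak']] : exists k', (k <= k' + 2 * size r')%N /\ sign_chain (coefs_opp q) k' z.-1.
  have [kr|rk] := ltnP k (2 * size r').
    exists 0%N; split; first by lia.
    by apply: sign_chain0; rewrite mulf_neq0 ?signr_eq0 // gt_eqF // q_gt0 //; lia.
  have [l al] : exists l, sign_chain f (k - 2 * size r') l.
    apply: (sign_chain_remove (e := fun x => x.1.2)
      (u := fun x => (-1) ^+ x.1.2 * x.1.1) (r := r') (i := i)).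
    rewrite subnK //; apply: sign_chain_eq a => j _.
    rewrite big_filter_cond /f; case: ltnP => jz.
      rewrite e coefs_oppD coefs_opp_row_poly addrC; congr (_ + _).
      by apply: eq_bigl => x; case: eqP => [->|_]; rewrite ?jz ?andbF.
    rewrite /coefs_opp nth_default // mulr0 big1 ?addr0 // => x /andP[xz /eqP ex].
    by rewrite ex ltnNge jz in xz.
  by have [k' [kk' ak']] := fP _ _ al; exists k'; split=> //; lia.
(* The coefficients of [q] from [z.-1] to its top index are positive, so q(-X) alternates
   [size q - z] times there. *)
exists (k' + (size q - z))%N, (z.-1 + (size q - z))%N; split; last by lia.
apply: sign_chain_run ak' _ => j hj; rewrite /coefs_opp exprS mulN1r mulNr mulrN oppr_lt0.
rewrite mulrACA -expr2 sqrr_sign mul1r mulr_gt0 // q_gt0 //; lia.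
Qed.

Definition monomial (a b : nat) : {poly R} := 'X^a * (1 - 'X) ^+ b.

Definition model_sum s : {poly R} := \sum_(x <- s) x.1.1 *: monomial x.1.2 x.2.

(** Regard the sum as a polynomial [P] in x over R[y]. Then [P - 1] has the root 1 - y; dividing by
    x - (1 - y) and comparing powers of x gives the recursion. *)
Lemma model_sum_quotient s : model_sum s = 1 ->
  exists Q : nat -> {poly R},
  [/\ 1 = row_poly [seq x <- s | x.2 == 0%N] + (1 - 'X) * Q 0%N,
      forall a, Q a = row_poly [seq x <- s | x.2 == a.+1] + (1 - 'X) * Q a.+1
    & exists m, forall a, (m <= a)%N -> Q a = 0].
Proof.
move=> s1.
pose P : {poly {poly R}} := \sum_(x <- s) (x.1.1 *: 'X^(x.1.2))%:P * 'X^(x.2).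
have coefP a : P`_a = row_poly [seq x <- s | x.2 == a].
  rewrite coef_sum /row_poly big_filter [RHS]big_mkcond; apply: eq_bigr => x _.
  by rewrite coefCM coefXn eq_sym; case: eqP; rewrite ?mulr1 ?mulr0.
have : root (P - 1) (1 - 'X).
  rewrite rootE hornerD hornerN hornerC horner_sum subr_eq0 -[eqbRHS]s1; apply/eqP.
  by apply: eq_bigr => x _; rewrite hornerM hornerC hornerXn -scalerAl.
move=> /factor_theorem[Q eQ].
have eP : P = 1 + Q * ('X - (1 - 'X)%:P) by rewrite -eQ addrCA subrr addr0.
exists (fun a => Q`_a); split; last by exists (size Q) => a; exact: nth_default.
  rewrite -coefP eP coefD coef1 mulrBr coefB coefMX coefMC /=; ring.
by move=> a; rewrite -coefP eP coefD coef1 mulrBr coefB coefMX coefMC /=; ring.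
Qed.

(** At X = 1 only the sum of the positive scalings survives, so [r] is empty. Hence a zero quotient
    is followed by zero quotients only. *)
Lemma row_eq0 r q : (forall x, x \in r -> 0 < x.1.1) ->
  0 = row_poly r + (1 - 'X) * q -> q = 0.
Proof.
move=> r_gt0 e.
have r0 : r = [::].
  have := congr1 (horner^~ 1) e.
  rewrite /= hornerD hornerM hornerD hornerN !hornerE subrr mul0r addr0.
  rewrite horner_sum; case: r r_gt0 {e} => // x r r_gt0 /eqP.
  rewrite big_cons hornerZ hornerXn expr1n mulr1 eq_sym gt_eqF // ltr_pwDl ?r_gt0 ?mem_head //.
  rewrite big_seq sumr_ge0 // => y yr; rewrite hornerZ hornerXn expr1n mulr1 ltW // r_gt0 //.
  by rewrite inE yr orbT.
move: e; rewrite r0 /row_poly big_nil add0r => /eqP; rewrite eq_sym mulf_eq0 => /orP[|/eqP //].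
by rewrite -size_poly_eq0 -opprB size_polyN -polyC1 size_XsubC.
Qed.

(** A model in Delta_k has k + 1 terms, so this says that degrees are at most 2k - 1. The estimates
    [lower] (ascending in [a]) and [upper] (descending) are combined at each [a]. *)
Lemma degree_bound s :
  (forall x, x \in s -> 0 < x.1.1) -> (forall x, x \in s -> (0 < x.1.2 + x.2)%N) ->
  model_sum s = 1 -> forall x, x \in s -> (x.1.2 + x.2 + 3 <= 2 * size s)%N.
Proof.
move=> s_gt0 s_neq0 s1 x xs.
have [Q [Q0 QS [m Qm]]] := model_sum_quotient s1.
pose row a := [seq x <- s | x.2 == a].
have row_gt0 a y : y \in row a -> 0 < y.1.1.
  by rewrite mem_filter => /andP[_ /s_gt0].
pose S a := count (fun x => (x.2 <= a)%N) s.
pose T a := count (fun x => (a < x.2)%N) s.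
have ST a : (S a + T a = size s)%N.
  rewrite -(count_predC (fun x => (x.2 <= a)%N)); congr (_ + _)%N.
  by apply: eq_count => y /=; rewrite ltnNge.
have S0 : S 0%N = size (row 0%N).
  by rewrite size_filter; apply: eq_count => y; rewrite leqn0.
have SS a : S a.+1 = (S a + size (row a.+1))%N.
  rewrite size_filter -count_predUI [X in (_ + X)%N](_ : _ = 0%N) ?addn0.
    by apply: eq_count => y /=; rewrite leq_eqVlt ltnS orbC.
  by rewrite (eq_count (a2 := pred0)) ?count_pred0 // => y /=; lia.
have TS a : T a = (size (row a.+1) + T a.+1)%N by have := SS a; have := ST a; have := ST a.+1; lia.
have lower a : Q a != 0 -> exists k i, sign_chain (coefs_opp (Q a)) k i /\
    (size (Q a) + a + 1 <= k + 2 * S a)%N.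
  elim: a => [|a IH] Qa0.
    (* The constant 1 acts as a quotient with index -1: it has size 1 and no sign change. *)
    have [i a1] := neq0_sign_chain (oner_neq0 {poly R}).
    have [|k [l [ak]]] := sign_chain_next_row_large Q0 (@row_gt0 0%N) (oner_neq0 _) _ a1.
      by rewrite size_poly1 size_poly_gt0.
    by rewrite size_poly1 -S0 => h; exists k, l; split=> //; lia.
  have Qp0 : Q a != 0.
    apply: contraNneq Qa0 => h; apply/eqP; apply: (row_eq0 (@row_gt0 a.+1)).
    by rewrite -h; exact: QS.
  have [k [i [ak hk]]] := IH Qp0.
  (* If the size drops, the drop pays for the increase of [a], and removing the row costs two
     changes per term. Otherwise the finer estimate is used. *)
  have [lt|ge] := ltnP (size (Q a.+1)) (size (Q a)); last first.
    have [k' [i' [ak' h]]] := sign_chain_next_row_large (QS a) (@row_gt0 a.+1) Qp0 ge ak.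
    have {}h : (k + size (Q a.+1) + 2 <= k' + 2 * size (row a.+1) + size (Q a))%N := h.
    by exists k', i'; split=> //; have := SS a; lia.
  have [kr|rk] := ltnP k (2 * size (row a.+1)).
    have [l al] := neq0_sign_chain Qa0; exists 0%N, l; split=> //.
    by have := SS a; lia.
  have [l al] : exists l, sign_chain (coefs_opp (Q a.+1)) (k - 2 * size (row a.+1)) l.
    by apply: (sign_chain_next_row (QS a)); rewrite subnK //; exact: ak.
  by exists (k - 2 * size (row a.+1))%N, l; split=> //; have := SS a; lia.
have upper a k i : sign_chain (coefs_opp (Q a)) k i -> (k + 2 <= 2 * T a)%N.
  (* The induction descends from [m], where the quotients vanish. The last nonzero quotient is a
     bare row, and there the gain of 2 arises. *)
  have [n] := ubnP (m - a); elim: n a k i => // n IH a k i mn ak.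
  have Qa0 : Q a != 0.
    by apply: contraTneq (sign_chain_neq0 ak) => ->; rewrite /coefs_opp coef0 mulr0 eqxx.
  have am : (a < m)%N by rewrite ltnNge; apply: contra Qa0 => /Qm ->.
  have IHS k' i' : sign_chain (coefs_opp (Q a.+1)) k' i' -> (k' + 2 <= 2 * T a.+1)%N.
    by apply: IH; lia.
  have [rk|kr] := leqP (2 * size (row a.+1)) k.
    have [l al] : exists l, sign_chain (coefs_opp (Q a.+1)) (k - 2 * size (row a.+1)) l.
      by apply: (sign_chain_next_row (QS a)); rewrite subnK //; exact: ak.
    by have := IHS _ _ al; have := TS a; lia.
  have [e0|/neq0_sign_chain[l al]] := eqVneq (Q a.+1) 0; last first.
    by have := IHS _ _ al; have := TS a; lia.
  have : (k + 2 <= 2 * size (row a.+1))%N.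
    apply: (sign_chain_monomials (e := fun x => x.1.2)
      (u := fun x => (-1) ^+ x.1.2 * x.1.1) (i := i)).
    by apply: sign_chain_eq ak => j _; rewrite -coefs_opp_row_poly QS e0 mulr0 addr0.
  by have := TS a; lia.
(* Adding [lower] and [upper] eliminates the number of changes [k], as [S a + T a] is the number of
   terms. *)
have bound a j : (Q a)`_j != 0 -> (j + a + 4 <= 2 * size s)%N.
  move=> nz; have Qa0 : Q a != 0 by apply: contraNneq nz => ->; rewrite coef0.
  have [k [i [ak hk]]] := lower _ Qa0; have := upper _ _ _ ak; have := ST a.
  have : (j < size (Q a))%N by rewrite ltnNge; apply: contra nz => ?; rewrite nth_default.
  lia.
have row_x : 0 < (row_poly (row x.2))`_x.1.2.
  rewrite coef_row_poly (perm_big (x :: rem x (row x.2))) /=; last first.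
    by apply: perm_to_rem; rewrite mem_filter eqxx xs.
  rewrite big_cons eqxx ltr_pwDl ?s_gt0 // big_seq_cond sumr_ge0 // => y /andP[/mem_rem yr _].
  by rewrite ltW // (row_gt0 x.2).
(* The coefficient of P at the exponents of [x] is positive, so by the recursion some coefficient of
   the quotient is nonzero in total degree at least that of [x] minus 1. *)
have := s_neq0 x xs; move: row_x.
case: (x.2) => [|a]; case: (x.1.2) => [|b] gt0 // _.
- have : (Q 0%N)`_b != 0 \/ (Q 0%N)`_b.+1 != 0.
    apply/orP; rewrite -negb_and; apply: contraTN gt0 => /andP[/eqP h1 /eqP h2].
    have := congr1 (fun f : {poly R} => f`_b.+1) Q0.
    by rewrite /= coef1 coefD coef_mul1BX h1 h2 subr0 addr0 => <-; rewrite ltxx.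
  by case=> /bound; lia.
- have : (Q a)`_0 != 0 \/ (Q a.+1)`_0 != 0.
    apply/orP; rewrite -negb_and; apply: contraTN gt0 => /andP[/eqP h1 /eqP h2].
    have := congr1 (fun f : {poly R} => f`_0) (QS a).
    by rewrite /= coefD coef0_mul1BX h1 h2 addr0 => <-; rewrite ltxx.
  by case=> /bound; lia.
- have : [\/ (Q a)`_b.+1 != 0, (Q a.+1)`_b != 0 | (Q a.+1)`_b.+1 != 0].
    apply/or3P; rewrite -!negb_and; apply: contraTN gt0 => /and3P[/eqP h1 /eqP h2 /eqP h3].
    have := congr1 (fun f : {poly R} => f`_b.+1) (QS a).
    by rewrite /= coefD coef_mul1BX h1 h2 h3 subr0 addr0 => <-; rewrite ltxx.
  by case=> /bound; lia.
Qed.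

End DegreeBound.

(** * The polynomials t^a (1 - t)^b *)

Section Monomials.
Variable R : realDomainType.
Implicit Types (a b : nat) (c : R).

Lemma size_1BX : size (1 - 'X : {poly R}) = 2.
Proof. by rewrite -opprB size_polyN -polyC1 size_XsubC. Qed.

Lemma monomialD a b a' b' :
  monomial R (a + a') (b + b') = monomial R a b * monomial R a' b'.
Proof. by rewrite /monomial !exprD mulrACA. Qed.

Lemma size_monomial a b : size (monomial R a b) = (a + b).+1.
Proof.
have nz : (1 - 'X : {poly R}) ^+ b != 0 by rewrite expf_neq0 // -size_poly_gt0 size_1BX.
by rewrite /monomial mulrC size_mulXn // polySpred // size_exp size_1BX mul1n addnS.
Qed.

Lemma monomial_neq0 a b : monomial R a b != 0.
Proof. by rewrite -size_poly_gt0 size_monomial. Qed.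

Lemma coef_monomial_top a b : (monomial R a b)`_(a + b) = (-1) ^+ b.
Proof.
have -> : (a + b = (size (monomial R a b)).-1)%N by rewrite size_monomial.
rewrite -lead_coefE lead_coefM lead_coefXn mul1r lead_coef_exp.
by rewrite -opprB lead_coefN -polyC1 lead_coefXsubC.
Qed.

(** The exponents are the orders of vanishing at 0 and at 1, and a divisor vanishes to no higher
    order. *)
Lemma leq_monomial a b a' b' c (q : {poly R}) : c != 0 ->
  monomial R a b * q = c *: monomial R a' b' -> (a <= a')%N /\ (b <= b')%N.
Proof.
move=> c0.
rewrite /monomial => e; split; rewrite leqNgt; apply/negP => lt.
  have X0 : ('X^a' : {poly R}) != 0 by rewrite expf_neq0 // polyX_eq0.
  have : 'X^a' * ('X^(a - a') * (1 - 'X) ^+ b * q) = 'X^a' * (c *: (1 - 'X) ^+ b').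
    by rewrite -scalerAr -e !mulrA -exprD subnKC // ltnW.
  move=> /(mulfI X0) /(congr1 (horner^~ 0)) /eqP.
  rewrite !hornerE expr0n subn_eq0 leqNgt lt /= !mul0r eq_sym.
  by rewrite subr0 expr1n mulr1 (negPf c0).
have X1 : ((1 - 'X) ^+ b' : {poly R}) != 0.
  by rewrite expf_neq0 // -size_poly_gt0 size_1BX.
have : (1 - 'X) ^+ b' * ('X^a * (1 - 'X) ^+ (b - b') * q) = (1 - 'X) ^+ b' * (c *: 'X^a').
  rewrite -scalerAr [_ * 'X^a']mulrC -e !mulrA; congr (_ * _).
  by rewrite mulrAC -exprD subnKC ?(ltnW lt) // mulrC.
move=> /(mulfI X1) /(congr1 (horner^~ 1)) /eqP.
rewrite !hornerE subrr expr0n subn_eq0 leqNgt lt /= mulr0 mul0r eq_sym.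
by rewrite expr1n mulr1 (negPf c0).
Qed.

Lemma scale_monomial_inj a b a' b' c c' : c != 0 -> c' != 0 ->
  c *: monomial R a b = c' *: monomial R a' b' -> (c, a, b) = (c', a', b').
Proof.
move=> c0 c'0 e.
have [aa' bb'] : (a <= a')%N /\ (b <= b')%N.
  by apply: (leq_monomial (q := c%:P) c'0); rewrite -e mulrC mul_polyC.
have [a'a b'b] : (a' <= a)%N /\ (b' <= b)%N.
  by apply: (leq_monomial (q := c'%:P) c0); rewrite e mulrC mul_polyC.
have ea : a = a' by lia.
have eb : b = b' by lia.
subst; have := congr1 (fun q : {poly R} => q`_(a' + b')) e.
by rewrite /= !coefZ coef_monomial_top => /(mulIf _) ->; rewrite ?signr_eq0.
Qed.

End Monomials.

(** * Fundamental models as finite sets of terms *)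

Section FundamentalSets.
Variable R : realType.
Implicit Types (x y tau : R * nat * nat) (f g : {fset (R * nat * nat)%type}).
Implicit Types (n d : nat) (w : R * nat * nat -> R).

Definition term_degree x := (x.1.2 + x.2)%N.

(** An enumeration-free form of [fundamental_models]: competing scalings are functions on triples,
    and the mass condition is a polynomial identity. *)
Record fundamental_set n d (f : {fset (R * nat * nat)%type}) : Prop := FundamentalSet {
  fset_card : size f = n.+1;
  fset_gt0 : forall x, x \in f -> 0 < x.1.1;
  fset_inj : {in f &, injective (fun x => (x.1.2, x.2))};
  fset_degree_gt0 : forall x, x \in f -> (0 < term_degree x)%N;
  fset_sum : model_sum f = 1;
  fset_uniq_weights : forall w, \sum_(x <- f) w x *: monomial R x.1.2 x.2 = 1 ->
    forall x, x \in f -> w x = x.1.1;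
  fset_degree_le : forall x, x \in f -> (term_degree x <= d)%N;
  fset_degree : exists2 x, x \in f & term_degree x = d }.

Lemma fundamental_models_set n d f : fundamental_models R n d f -> fundamental_set n d f.
Proof.
case=> c [nu [mu [[fc uw] <- ->]]]; have sumE := sum_polyE fc.
case: fc => c_gt0 inj nz _.
pose h i := (c i, nu i, mu i).
have h_inj : injective h by move=> i j [_ e1 e2]; apply: inj; rewrite e1 e2.
have memP x : reflect (exists i, x = h i) (x \in triples c nu mu).
  by rewrite /triples; apply: (iffP (imfsetP _ _ _ _)) => [[i _ ->]|[i ->]]; exists i.
have perm : perm_eq (triples c nu mu) [seq h i | i <- enum 'I_n.+1].
  apply: uniq_perm => [||x]; [exact: fset_uniq|by rewrite (map_inj_uniq h_inj); exact: enum_uniq|].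
  apply/memP/mapP => [[i ->]|[i _ ->]]; exists i => //; exact: mem_enum.
have bigE (F : R * nat * nat -> {poly R}) :
    \sum_(x <- triples c nu mu) F x = \sum_(i < n.+1) F (h i).
  by rewrite (perm_big _ perm) big_map big_enum.
split.
- by rewrite (perm_size perm) size_map -cardE card_ord.
- by move=> _ /memP[i ->]; exact: c_gt0.
- by move=> _ _ /memP[i ->] /memP[j ->] /inj ->.
- move=> _ /memP[i ->]; rewrite lt0n addn_eq0; apply/andP => -[/eqP /= e1 /eqP /= e2].
  by apply: (nz i); rewrite e1 e2.
- by rewrite /model_sum bigE.
- by move=> w; rewrite bigE => /(uw (fun i => w (h i))) e _ /memP[i ->]; exact: e.
- move=> _ /memP[i ->]; exact: (leq_bigmax (F := fun i => (nu i + mu i)%N)).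
- have [|i e] := @bigop.eq_bigmax _ (fun i : 'I_n.+1 => (nu i + mu i)%N); first by rewrite card_ord.
  by exists (h i); [apply/memP; exists i|rewrite /model_degree e].
Qed.

Lemma fundamental_set_models n d f : fundamental_set n d f -> fundamental_models R n d f.
Proof.
case=> card gt0 inj deg_gt0 sum1 uw deg_le [y yf deg_y].
pose h (i : 'I_n.+1) := nth y f i.
have hf i : h i \in f by rewrite mem_nth // card.
have bigE (F : R * nat * nat -> {poly R}) : \sum_(x <- f) F x = \sum_(i < n.+1) F (h i).
  by rewrite (big_nth y) card big_mkord.
have h_inj : injective h.
  by move=> i j /eqP; rewrite nth_uniq ?card ?fset_uniq // => /eqP/val_inj.
have h_index x : x \in f -> h (inord (index x f)) = x.
  by move=> xf; rewrite /h inordK ?nth_index // -card index_mem.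
exists (fun i => (h i).1.1), (fun i => (h i).1.2), (fun i => (h i).2); split.
- split.
    split=> [i|i j e|i [e1 e2]|t _]; first exact: gt0.
    - by apply: h_inj; apply: inj.
    - by have := deg_gt0 _ (hf i); rewrite /term_degree e1 e2.
    - have := congr1 (horner^~ t) sum1; rewrite /model_sum bigE hornerC horner_sum => {2}<-.
      by apply: eq_bigr => i _; rewrite hornerZ hornerM !horner_exp !hornerE.
  move=> c' e i; have {2}-> : i = inord (index (h i) f).
    by apply: h_inj; rewrite h_index.
  rewrite h_index //; have := uw (fun x => c' (inord (index x f))).
  rewrite bigE => /(_ _ _ (hf i)) <-.
    by congr c'; apply: h_inj; rewrite h_index.
  by rewrite -e; apply: eq_bigr => j _; congr (c' _ *: _); apply: h_inj; rewrite h_index.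
- apply/eqP; rewrite eqn_leq; apply/andP; split; first by apply/bigmax_leqP => i _; exact: deg_le.
  by rewrite -deg_y -(h_index _ yf); exact: (leq_bigmax (F := fun i => term_degree (h i))).
- apply/fsetP => x; apply/idP/imfsetP => [xf|[i _ ->]]; last by case: (h i) (hf i) => [[]].
  by exists (inord (index x f)) => //; rewrite h_index //; case: x {xf} => [[]].
Qed.

End FundamentalSets.

(** * Grafting a model onto a top term of another *)

Section Composition.
Variable R : realType.
Implicit Types (x y tau : R * nat * nat) (f g : {fset (R * nat * nat)%type}).
Implicit Types (n d : nat) (w : R * nat * nat -> R).

(* Comparing coefficients of [t ^ d] in the total mass identity: the terms of top
   degree [d] contribute their scaling with sign [(-1) ^ mu]. *)
Lemma exists_top_term n d f (b : bool) : fundamental_set n d f -> (0 < d)%N ->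
  exists2 x, x \in f & (term_degree x == d) && (odd x.2 == b).
Proof.
move=> F d0; have [y yf dy] := fset_degree F.
have [/hasP //|/hasPn no] := boolP (has (fun x => (term_degree x == d) && (odd x.2 == b)) f).
pose u x := if term_degree x == d then x.1.1 else 0.
(* If the parity [b] is missing, all top terms contribute to t^d with the same sign and cannot
   cancel. *)
have coefE x : x \in f -> (x.1.1 *: monomial R x.1.2 x.2)`_d = (-1) ^+ (~~ b) * u x.
  move=> xf; rewrite coefZ /u; have := no x xf; case: eqP => [<- /= ob|/eqP nd _].
    rewrite /term_degree coef_monomial_top -signr_odd mulrC; congr (_ ^+ _ * _).
    by move: ob; case: odd; case: b {no}.
  rewrite nth_default ?mulr0 // size_monomial ltn_neqAle nd; exact: fset_degree_le F _ xf.
have := congr1 (fun q : {poly R} => q`_d) (fset_sum F).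
rewrite /= coef_sum coef1 gtn_eqF // big_seq (eq_bigr _ coefE) -mulr_sumr => /eqP.
rewrite mulf_eq0 signr_eq0 /= psumr_eq0.
  by move=> /allP/(_ _ yf); rewrite yf /u dy eqxx gt_eqF // (fset_gt0 F).
move=> x xf; rewrite /u; case: ifP => // _; exact/ltW/(fset_gt0 F).
Qed.

Definition term_mul tau x : R * nat * nat :=
  (tau.1.1 * x.1.1, (tau.1.2 + x.1.2)%N, (tau.2 + x.2)%N).

Lemma term_degree_mul tau x :
  term_degree (term_mul tau x) = (term_degree tau + term_degree x)%N.
Proof. by rewrite /term_degree /= addnACA. Qed.

Lemma term_mul_inj tau : tau.1.1 != 0 -> injective (term_mul tau).
Proof.
by move=> t0 [[c a] b] [[c' a'] b'] [/(mulfI t0) -> /addnI -> /addnI ->].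
Qed.

Definition graft f tau g := (f `\ tau) `|` [fset term_mul tau x | x in g].

Section Graft.
Variables (m d l e : nat) (f g : {fset (R * nat * nat)%type}) (tau : R * nat * nat).
Hypotheses (F : fundamental_set m d f) (G : fundamental_set l e g).
Hypotheses (tau_f : tau \in f) (tau_top : term_degree tau = d).

Let tau_neq0 : tau.1.1 != 0.
Proof. by rewrite gt_eqF // (fset_gt0 F). Qed.

(** Terms of [g] have positive degree, so their products with [tau] exceed [d]: the degree separates
    kept terms from new ones. *)
Lemma mem_graft_low x : (x \in graft f tau g) && (term_degree x <= d)%N = (x \in f `\ tau).
Proof.
apply/andP/idP => [[]|xf].
  rewrite inE => /orP[//|/imfsetP[y /= yg ->]].
  by rewrite term_degree_mul tau_top; have := fset_degree_gt0 G yg; lia.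
by rewrite inE xf; move: xf; rewrite !inE => /andP[_ /(fset_degree_le F)].
Qed.

Lemma mem_graft_high x : (x \in graft f tau g) && (d < term_degree x)%N =
  (x \in [fset term_mul tau y | y in g]).
Proof.
apply/andP/idP => [[]|xg].
  rewrite inE => /orP[|//]; rewrite !inE => /andP[_ /(fset_degree_le F)]; lia.
rewrite inE xg orbT; split=> //; move: xg => /imfsetP[y /= yg ->].
by rewrite term_degree_mul tau_top; have := fset_degree_gt0 G yg; lia.
Qed.

Lemma perm_graft : perm_eq (graft f tau g) (f `\ tau ++ [seq term_mul tau x | x <- g]).
Proof.
apply: uniq_perm => [||x]; first exact: fset_uniq.
  rewrite cat_uniq fset_uniq (map_inj_uniq (term_mul_inj tau_neq0)) fset_uniq andbT /=.
  apply/hasPn => _ /mapP[y yg ->]; apply/negP; rewrite -[_ \in _]mem_graft_low.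
  by rewrite term_degree_mul tau_top; have := fset_degree_gt0 G yg; lia.
rewrite mem_cat inE; congr (_ || _).
by apply/imfsetP/mapP => -[y yg ->]; exists y.
Qed.

Lemma perm_graft_root : perm_eq f (tau :: f `\ tau).
Proof.
apply: uniq_perm => [||x]; first exact: fset_uniq.
  by rewrite /= fset_uniq andbT !inE eqxx.
by rewrite !inE; case: eqP => [->|].
Qed.

Lemma size_graft : size (graft f tau g) = (m + l).+1.
Proof.
rewrite (perm_size perm_graft) size_cat size_map (fset_card G).
by have := perm_size perm_graft_root; rewrite /= (fset_card F) => -[<-]; rewrite addnS.
Qed.

Lemma fundamental_set_graft : fundamental_set (m + l) (d + e) (graft f tau g).
Proof.
have memP x : x \in graft f tau g -> (x \in f `\ tau) \/ exists2 y, y \in g & x = term_mul tau y.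
  by rewrite inE => /orP[|/imfsetP[y yg ->]]; [left|right; exists y].
have bigE w : \sum_(x <- graft f tau g) w x *: monomial R x.1.2 x.2 =
    \sum_(x <- f `\ tau) w x *: monomial R x.1.2 x.2 +
    monomial R tau.1.2 tau.2 * \sum_(x <- g) w (term_mul tau x) *: monomial R x.1.2 x.2.
  rewrite (perm_big _ perm_graft) big_cat big_map /= mulr_sumr; congr (_ + _).
  by apply: eq_bigr => x _; rewrite monomialD scalerAr.
have bigf w : \sum_(x <- f) w x *: monomial R x.1.2 x.2 =
    w tau *: monomial R tau.1.2 tau.2 + \sum_(x <- f `\ tau) w x *: monomial R x.1.2 x.2.
  by rewrite (perm_big _ perm_graft_root) big_cons.
have sub x : x \in f `\ tau -> x \in f by rewrite !inE => /andP[].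
split.
- exact: size_graft.
- move=> x /memP[/sub /(fset_gt0 F) //|[y yg ->]].
  by apply: mulr_gt0; [exact: fset_gt0 F _ tau_f|exact: fset_gt0 G _ yg].
- have cross x y : x \in f `\ tau -> y \in g ->
      (x.1.2, x.2) = ((term_mul tau y).1.2, (term_mul tau y).2) -> False.
    move=> /sub/(fset_degree_le F) xd /(fset_degree_gt0 G) yd [e1 e2].
    have : term_degree x = term_degree (term_mul tau y) by rewrite /term_degree e1 e2.
    by rewrite term_degree_mul tau_top; lia.
  move=> x y /memP[xf|[x' xg ->]] /memP[yf|[y' yg ->]].
  + by apply: (fset_inj F); exact: sub.
  + by move=> /(cross _ _ xf yg).
  + by move=> /esym /(cross _ _ yf xg).
  + by move=> [/addnI e1 /addnI e2]; congr term_mul; apply: (fset_inj G); rewrite // e1 e2.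
- move=> x /memP[/sub/(fset_degree_gt0 F) //|[y yg ->]].
  by rewrite term_degree_mul; have := fset_degree_gt0 G yg; lia.
- rewrite /model_sum bigE /= -(fset_sum F) /model_sum bigf addrC; congr (_ + _).
  have -> : \sum_(x <- g) (tau.1.1 * x.1.1) *: monomial R x.1.2 x.2 = tau.1.1 *: model_sum g.
    by rewrite /model_sum scaler_sumr; apply: eq_bigr => x _; rewrite scalerA.
  by rewrite (fset_sum G) -scalerAr mulr1.
- move=> w; rewrite bigE; set A : {poly R} := \sum_(x <- f `\ tau) _.
  set B : {poly R} := \sum_(x <- g) _ => AB.
  have [beta eB] : exists beta : R, B = beta%:P.
    exists B`_0; apply: size1_polyC.
    have [->|B0] := eqVneq B 0; first by rewrite size_poly0.
    have : (size (monomial R tau.1.2 tau.2 * B)%R <= d.+1)%N.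
      rewrite (_ : _ * B = 1 - A); last by rewrite -AB addrAC subrr add0r.
      rewrite (leq_trans (size_polyD _ _)) // geq_max size_poly1 size_polyN /=.
      rewrite /A big_seq; apply: (big_ind (fun q : {poly R} => (size q <= d.+1)%N)).
      - by rewrite size_poly0.
      - by move=> p q hp hq; rewrite (leq_trans (size_polyD _ _)) // geq_max hp.
      - move=> x /sub/(fset_degree_le F) xd; apply: leq_trans (size_scale_leq _ _) _.
        by rewrite size_monomial.
    rewrite size_mul ?monomial_neq0 // size_monomial; move: tau_top; rewrite /term_degree.
    by set z := size B; lia.
  (* With weight [beta] at [tau], [AB] becomes an identity for [f], whose uniqueness fixes the
     weights on the kept terms and makes [beta] the scaling of [tau]. *)
  have := fset_uniq_weights F (w := fun x => if x == tau then beta else w x).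
  rewrite bigf eqxx; set A' := \sum_(x <- f `\ tau) _.
  have -> : A' = A.
    rewrite /A' /A 2!big_seq; apply: eq_bigr => x.
    by rewrite !inE => /andP[/negPf ->].
  rewrite addrC -mul_polyC mulrC -eB => /(_ AB) wf x /memP[xf|[y yg ->]].
    by move: (wf x (sub x xf)); move: xf; rewrite !inE => /andP[/negPf ->].
  have := wf _ tau_f; rewrite eqxx => eb.
  (* Now [B] equals the scaling of [tau]; dividing by it gives an identity for [g]. *)
  have := fset_uniq_weights G (w := fun x => tau.1.1^-1 * w (term_mul tau x)).
  have -> : \sum_(x <- g) (tau.1.1^-1 * w (term_mul tau x)) *: monomial R x.1.2 x.2 =
      tau.1.1^-1 *: B.
    by rewrite /B scaler_sumr; apply: eq_bigr => z _; rewrite scalerA.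
  rewrite eB eb -mul_polyC -polyCM mulVf // => /(_ (erefl _) _ yg) /= <-.
  by rewrite mulrA mulfV // mul1r.
- move=> x /memP[/sub/(fset_degree_le F)|[y /(fset_degree_le G) yg ->]]; first by lia.
  by rewrite term_degree_mul tau_top leq_add2l.
- have [y yg <-] := fset_degree G; exists (term_mul tau y); last by rewrite term_degree_mul tau_top.
  by rewrite inE; apply/orP; right; apply/imfsetP; exists y.
Qed.

End Graft.

Lemma graft_sharp_ltF m l l' e e' m' f g f' g' tau tau' :
  fundamental_set m (2 * m - 1) f -> fundamental_set l e g ->
  fundamental_set m' (2 * m' - 1) f' -> fundamental_set l' e' g' ->
  tau \in f -> term_degree tau = (2 * m - 1)%N ->
  tau' \in f' -> term_degree tau' = (2 * m' - 1)%N ->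
  graft f tau g = graft f' tau' g' -> (0 < m)%N -> (m < m')%N -> False.
Proof.
move=> F G F' G' tf tt tf' tt' E m0 mm'.
(* These terms of [g] are the ones whose products with [tau] lie in [f'] without [tau']. *)
pose g1 := [seq x <- g | (term_degree (term_mul tau x) <= 2 * m' - 1)%N].
have t0 : tau.1.1 != 0 by rewrite gt_eqF // (fset_gt0 F).
have t'0 : tau'.1.1 != 0 by rewrite gt_eqF // (fset_gt0 F').
have perm : perm_eq (f' `\ tau') (f `\ tau ++ [seq term_mul tau x | x <- g1]).
  have := perm_graft F G tf tt; move=> /(perm_filter (fun x => (term_degree x <= 2 * m' - 1)%N)).
  rewrite filter_cat filter_map (_ : [seq x <- f `\ tau | _] = f `\ tau); last first.
    apply/all_filterP/allP => x; rewrite !inE => /andP[_ /(fset_degree_le F)]; lia.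
  apply: perm_trans; apply: uniq_perm; rewrite ?filter_uniq ?fset_uniq // => x.
  by rewrite mem_filter andbC E (mem_graft_low F' G' tf' tt').
have size_g1 : (m' = m + size g1)%N.
  have := perm_size perm; rewrite size_cat size_map.
  have := perm_size (perm_graft_root tf); rewrite (fset_card F) /= => -[<-].
  by have := perm_size (perm_graft_root tf'); rewrite (fset_card F') /= => -[<-].
(* Both [f] and [f'] have mass 1; cancelling their common terms expresses [tau'] as [tau] times 1
   minus the sum of [g1]. *)
have e1 : monomial R tau.1.2 tau.2 * (tau.1.1 *: (1 - model_sum g1)) =
    tau'.1.1 *: monomial R tau'.1.2 tau'.2.
  have : model_sum f = model_sum f' by rewrite (fset_sum F) (fset_sum F').
  rewrite /model_sum (perm_big _ (perm_graft_root tf)) (perm_big _ (perm_graft_root tf')).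
  rewrite !big_cons (perm_big _ perm) big_cat big_map /= [X in _ + (_ + X)](_ : _ =
    monomial R tau.1.2 tau.2 * (tau.1.1 *: model_sum g1)); last first.
    rewrite scaler_sumr mulr_sumr; apply: eq_bigr => x _.
    by rewrite monomialD scalerA scalerAr.
  rewrite [RHS]addrCA [RHS]addrC => /addIr h.
  by rewrite scalerBr mulrBr -[X in X - _]scalerAr mulr1 h addrK.
have [le1 le2] := leq_monomial t'0 e1.
(* The quotient of [tau'] by [tau] completes [g1] to m' - m + 1 terms of mass 1. Its degree 2(m' -
   m) exceeds [degree_bound] by one. *)
pose x : R * nat * nat :=
  (tau'.1.1 / tau.1.1, (tau'.1.2 - tau.1.2)%N, (tau'.2 - tau.2)%N).
have deg_x : term_degree x = (2 * (m' - m))%N.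
  by move: tt tt'; rewrite /term_degree /=; lia.
have sum1 : model_sum (x :: g1) = 1.
  suff ex : x.1.1 *: monomial R x.1.2 x.2 = 1 - model_sum g1.
    by rewrite /model_sum big_cons ex subrK.
  apply: (mulfI (monomial_neq0 R tau.1.2 tau.2)).
  rewrite -scalerAr -monomialD /= !subnKC // [_ / _]mulrC -scalerA -e1.
  by rewrite -scalerAr scalerA mulVf // scale1r.
have := degree_bound _ _ sum1 (mem_head x g1).
rewrite -/(term_degree x) deg_x /=; move=> h.
suff : (2 * (m' - m) + 3 <= 2 * (size g1).+1)%N by lia.
apply: h => y; rewrite inE mem_filter => /orP[/eqP ->|/andP[_ yg]].
- by apply: divr_gt0; [exact: fset_gt0 F' _ tf'|exact: fset_gt0 F _ tf].
- exact: fset_gt0 G _ yg.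
- by rewrite -/(term_degree x) deg_x; lia.
- exact: fset_degree_gt0 G _ yg.
Qed.

(** The terms of degree at most [d] give [f] without [tau], the total mass then gives [tau], and
    dividing the other terms by [tau] gives [g]. *)
Lemma graft_inj m l l' d e e' f g f' g' tau tau' :
  fundamental_set m d f -> fundamental_set l e g ->
  fundamental_set m d f' -> fundamental_set l' e' g' ->
  tau \in f -> term_degree tau = d -> tau' \in f' -> term_degree tau' = d ->
  graft f tau g = graft f' tau' g' -> [/\ f = f', tau = tau' & g = g'].
Proof.
move=> F G F' G' tf tt tf' tt' E.
have t0 : tau.1.1 != 0 by rewrite gt_eqF // (fset_gt0 F).
have t'0 : tau'.1.1 != 0 by rewrite gt_eqF // (fset_gt0 F').
have eL : f `\ tau = f' `\ tau'.
  by apply/fsetP => x; rewrite -(mem_graft_low F G tf tt) E (mem_graft_low F' G' tf' tt').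
have et : tau = tau'.
  have : model_sum f = model_sum f' by rewrite (fset_sum F) (fset_sum F').
  rewrite /model_sum (perm_big _ (perm_graft_root tf)) (perm_big _ (perm_graft_root tf')).
  rewrite !big_cons eL => /addIr /(scale_monomial_inj t0 t'0).
  by case: tau {tf tt t0 E eL} => [[]]; case: tau' {tf' tt' t'0} => [[]].
split=> //; first by rewrite -(fsetD1K tf) eL -et; rewrite et fsetD1K.
have eH : [fset term_mul tau y | y in g] = [fset term_mul tau y | y in g'].
  apply/fsetP => x; rewrite -(mem_graft_high F G tf tt) E et.
  by rewrite (mem_graft_high F' G' tf' tt').
have inj := term_mul_inj t0.
apply/fsetP => y; apply/idP/idP => yg.
  have : term_mul tau y \in [fset term_mul tau y | y in g] by apply/imfsetP; exists y.
  by rewrite eH => /imfsetP[z /= zg /inj ->].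
have : term_mul tau y \in [fset term_mul tau y | y in g'] by apply/imfsetP; exists y.
by rewrite -eH => /imfsetP[z /= zg /inj ->].
Qed.

End Composition.

(** * Counting grafts by pairs of models and the parity of the top term *)

Theorem proposition6p4 (R : realType) (n : nat) (hn : (3 <= n)%N) :
  (2 * \sum_(1 <= i < n) sharp_count R i * sharp_count R (n - i)
     <= num_fundamental R n (2 * n - 2))%N.
Proof.
pose F i : seq {fset (R * nat * nat)%type} := fset_set (fundamental_models R i (2 * i - 1)).
have FP i f : f \in F i -> fundamental_set i (2 * i - 1) f.
  rewrite in_fset_set; last exact: fundamental_models_finite.
  by rewrite inE => /fundamental_models_set.
(* For positive [i] and [f] in [F i] the filtered list is nonempty by [exists_top_term], so the
   default triple does not occur. *)
pose top i (f : {fset (R * nat * nat)%type}) (b : bool) : R * nat * nat :=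
  head (0, 0%N, 0%N) [seq x <- f | (term_degree x == 2 * i - 1)%N && (odd x.2 == b)].
have topP i f b : (0 < i)%N -> f \in F i ->
    [/\ top i f b \in f, term_degree (top i f b) = (2 * i - 1)%N & odd (top i f b).2 = b].
  move=> i0 /FP Ff.
  have [|x xf px] := exists_top_term b Ff; first by lia.
  have : top i f b \in [seq x <- f | (term_degree x == 2 * i - 1)%N && (odd x.2 == b)].
    rewrite /top; have : x \in [seq x <- f | (term_degree x == 2 * i - 1)%N && (odd x.2 == b)].
      by rewrite mem_filter px.
    by case: [seq _ <- _ | _] => //= y s _; exact: mem_head.
  by rewrite mem_filter => /andP[/andP[/eqP -> /eqP ->] ->].
pose t i := [seq (fg, b) | fg <- [seq (f, g) | f <- F i, g <- F (n - i)%N], b <- [:: true; false]].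
pose G i (p : _ * bool) := graft p.1.1 (top i p.1.1 p.2) p.1.2.
pose s := [seq G i p | i <- index_iota 1 n, p <- t i].
have -> : (2 * \sum_(1 <= i < n) sharp_count R i * sharp_count R (n - i))%N = size s.
  rewrite size_allpairs_dep sumnE big_map big_distrr /=; apply: eq_bigr => i _.
  by rewrite !size_allpairs mulnC.
have tP i p : p \in t i -> [/\ p.1.1 \in F i & p.1.2 \in F (n - i)%N].
  by move=> /allpairsP[[fg b] /= [/allpairsP[[f g] /= [fF gF ->]] _ ->]].
rewrite /num_fundamental; apply: uniq_leq_size.
  apply: allpairs_uniq_dep; first exact: iota_uniq.
    move=> i _; apply: allpairs_uniq => //; last by move=> [? ?] [? ?] _ _ [-> ->].
    by apply: allpairs_uniq; rewrite ?fset_uniq // => -[? ?] [? ?] _ _ [-> ->].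
  move=> u v /allpairsPdep[i [p [/= hi hp ->]]] /allpairsPdep[j [q [/= hj hq ->]]] /= E.
  move: hi hj; rewrite !mem_index_iota => /andP[i0 _] /andP[j0 _].
  have [pf pg] := tP _ _ hp; have [qf qg] := tP _ _ hq.
  have [pt pd po] := topP i _ p.2 i0 pf; have [qt qd qo] := topP j _ q.2 j0 qf.
  have [ij|ji|ij] := ltngtP i j.
  - by case: (graft_sharp_ltF (FP _ _ pf) (FP _ _ pg) (FP _ _ qf) (FP _ _ qg) pt pd qt qd E).
  - by case: (graft_sharp_ltF (FP _ _ qf) (FP _ _ qg) (FP _ _ pf) (FP _ _ pg) qt qd pt pd (esym E)).
  subst j.
  have [e1 e2 e3] := graft_inj (FP _ _ pf) (FP _ _ pg) (FP _ _ qf) (FP _ _ qg) pt pd qt qd E.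
  (* The parity of the top term recovers the choice of [b]. *)
  have e4 : p.2 = q.2 by rewrite -po -qo e2.
  congr (Tagged _ _); move: e1 e3 e4.
  case: p {hp pf pg pt pd po E e2} => [[? ?] ?].
  by case: q {hq qf qg qt qd qo} => [[? ?] ?] /= -> -> ->.
move=> h /allpairsPdep[i [p [/= hi hp ->]]].
move: hi; rewrite mem_index_iota => /andP[i0 ltn].
have [pf pg] := tP _ _ hp; have [pt pd _] := topP i _ p.2 i0 pf.
rewrite in_fset_set; last exact: fundamental_models_finite.
rewrite inE; apply: fundamental_set_models.
(* As 0 < i < n, none of these subtractions is truncated. *)
have -> : (2 * n - 2 = (2 * i - 1) + (2 * (n - i) - 1))%N by lia.
rewrite -[n in fundamental_set n](subnKC (ltnW ltn)).
exact: fundamental_set_graft (FP _ _ pf) (FP _ _ pg) pt pd.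
Qed.
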